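(* Let $(\mathsf X, d, \preceq)$ be a preordered metric space such that $d$ is complete and satisfies the diagonal property with respect to $\preceq$, and such that the preorder $\preceq$ is closed with respect to $d$. Let $\mathbb T$ be either $\mathbb R_+$ or $\mathbb Z_+$ and let $(T_t)_{t\in\mathbb T}$ be an order-preserving semigroup on $\mathsf X$. Then the following statements are equivalent: (i) $(T_t)$ is asymptotically contractive and has at least one order-bounded trajectory. (ii) $(T_t)$ is globally stable.
   Context: A preorder is a reflexive transitive relation. A preordered metric space is a triple $(\mathsf X,d,\preceq)$ with $(\mathsf X,d)$ a metric space and $\preceq$ a preorder on $\mathsf X$. For $a\preceq b$, the order interval is $[a,b]=\{x\in\mathsf X: a\preceq x\preceq b\}$. The preorder is closed if $x_i\preceq y_i$ for all $i\in\mathbb N$, $x_i\to x$ and $y_i\to y$ in $\mathsf X$ imply $x\preceq y$. The metric $d$ has the diagonal property with respect to $\preceq$ if, for all $a,b\in \mathsf X$, $d(x,y)\le d(a,b)$ whenever $x,y\in[a,b]$. A semigroup on $\mathsf X$ is a family $(T_t)_{t\in\mathbb T}$ of maps $T_t:\mathsf X\to\mathsf X$ with $T_0$ the identity and $T_{s+t}=T_s\circ T_t$ for all $s,t\in\mathbb T$ (no continuity in $t$ or $x$ is required). It is order-preserving if, for every $t\in\mathbb T$, $x\preceq y$ implies $T_tx\preceq T_ty$. The trajectory of $x$ is $t\mapsto T_tx$; it is order-bounded if there exist $a,b\in\mathsf X$ with $a\preceq T_tx\preceq b$ for all $t\in\mathbb T$. The semigroup is asymptotically contractive if $d(T_tx,T_ty)\to0$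 as $t\to\infty$ for all $x,y\in\mathsf X$. A stationary point is an $x^*\in\mathsf X$ with $T_tx^*=x^*$ for all $t\in\mathbb T$. The semigroup is globally stable if it has a unique stationary point $x^*\in\mathsf X$ and $d(T_tx,x^* )\to0$ as $t\to\infty$ for all $x\in\mathsf X$. *)

(* Defs.v *)
From Corelib Require Import RelationClasses.
From mathcomp Require Import all_boot all_order all_algebra.
From mathcomp Require Import all_classical all_reals all_analysis.

Set Implicit Arguments.
Unset Strict Implicit.
Unset Printing Implicit Defensive.

Import Order.TTheory GRing.Theory Num.Theory.
Import numFieldNormedType.Exports.

Local Open Scope classical_set_scope.
Local Open Scope ring_scope.

(* A preordered metric space is a metricType X with a relation le satisfying
   the PreOrder class. The structures metricType and Order.preorderType cannot
   be combined into one: Hierarchy Builder rejects their join because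
   POrderedTopological has already been declared. *)

Section PreorderedMetricSpaces.
Context (R : realType) (X : metricType R).
Variable le : X -> X -> Prop.

(* The library's completeType is pointed; here the space may be empty, so
   completeness is stated as a property, through Cauchy sequences. *)
Definition complete_metric : Prop :=
  forall u : nat -> X, cauchy (u @ \oo) -> exists x : X, u @ \oo --> x.

(* If le a b fails this set is empty, by transitivity. *)
Definition order_interval (a b : X) : set X := [set x | le a x /\ le x b].

Definition diagonal_property : Prop :=
  forall a b x y : X, order_interval a b x -> order_interval a b y ->
    mdist x y <= mdist a b.

Definition closed_preorder : Prop :=
  forall (u v : nat -> X) (x y : X), (forall i, le (u i) (v i)) ->
    u @ \oo --> x -> v @ \oo --> y -> le x y.

End PreorderedMetricSpaces.

(* The two time sets are viewed as subsets of R; a semigroup is then a family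
   indexed by R of which only the members with index in the time set matter. *)
Definition is_time_set (R : realType) (TT : set R) : Prop :=
  TT = [set t : R | 0 <= t] \/ TT = range (fun n : nat => n%:R : R).

Section Semigroups.
Context (R : realType) (X : metricType R).
Variables (le : X -> X -> Prop) (TT : set R) (T : R -> X -> X).

Definition semigroup : Prop :=
  T 0 = id /\ forall s t, TT s -> TT t -> T (s + t) = T s \o T t.

Definition order_preserving : Prop :=
  forall t, TT t -> forall x y : X, le x y -> le (T t x) (T t y).

Definition order_bounded_trajectory (x : X) : Prop :=
  exists a b : X, forall t, TT t -> order_interval le a b (T t x).

Definition asymptotically_contractive : Prop :=
  forall x y : X,
    mdist (T t x) (T t y) @[t --> within TT (pinfty_nbhs R)] --> (0 : R).

Definition stationary (x : X) : Prop := forall t, TT t -> T t x = x.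

Definition globally_stable : Prop :=
  exists xs : X, unique stationary xs /\
    forall x : X,
      mdist (T t x) xs @[t --> within TT (pinfty_nbhs R)] --> (0 : R).

End Semigroups.

(* Main.v *)
Require Import Defs.
From Corelib Require Import RelationClasses.
From mathcomp Require Import all_boot all_order all_algebra.
From mathcomp Require Import all_classical all_reals all_analysis.

(** Let x have its trajectory in [a, b]. Order preservation and the semigroup
law give [T_n a ⪯ T_(n+k) x ⪯ T_n b], so the tail of the trajectory from time n
on lies in the order interval [T_n a, T_n b]. Contractivity makes the distance
of its endpoints tend to 0, and by the diagonal property this distance bounds
the diameter of the interval: completeness and closedness then yield a limit xs
lying in every one of these intervals ([nested_order_intervals]).

The maps T_t need not be continuous, so invariance of the limit is again an
order argument. The points xs and T_n x both lie in [T_n a, T_n b]; applying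
T_t puts T_t xs and T_t (T_n x) between T_n (T_t a) and T_n (T_t b), whose
distance tends to 0 by contractivity for the pair T_t a, T_t b. Hence
T_t (T_n x) = T_n (T_t x) tends to T_t xs; but it is asymptotic to T_n x, which
tends to xs. So T_t xs = xs ([order_bounded_stationary]).

Contractivity against a stationary point gives uniqueness and attraction
([contractive_globally_stable]). Conversely, two trajectories attracted by the
same point approach each other ([globally_stable_contractive]), and a
stationary trajectory is bounded by its own value. Integer times, which both
time sets contain, give all the limits that identify points. *)

Import Order.TTheory GRing.Theory Num.Theory.
Import numFieldNormedType.Exports.

Local Open Scope classical_set_scope.
Local Open Scope ring_scope.

Section MetricSequences.
Set Implicit Arguments.
Unset Strict Implicit.
Context (R : realType) (X : metricType R).

Lemma cvg_mdist0 (u v : nat -> X) (x : X) :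
  mdist (u n) (v n) @[n --> \oo] --> (0 : R) ->
  u @ \oo --> x -> v @ \oo --> x.
Proof.
move=> uv ux; apply/metricType_numDomainType.cvgrPdist_lt => e e0.
have e20 : 0 < e / 2 by rewrite divr_gt0.
near=> n; apply: le_lt_trans (metric_triangle _ (u n) _) _.
rewrite [ltRHS]splitr ltrD//; near: n.
  exact: metricType_numDomainType.cvgr_dist_lt.
apply: filterS (cvgr0_norm_lt _ uv _ e20) => n.
exact/le_lt_trans/ler_norm.
Unshelve. all: by end_near. Qed.

End MetricSequences.

Section OrderIntervals.
Set Implicit Arguments.
Unset Strict Implicit.
Context (R : realType) (X : metricType R) (le : X -> X -> Prop).
Hypothesis diag : diagonal_property le.

(** The diagonal property bounds [mdist x (u n)] by the distance of the endpoints.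
This is what replaces continuity of the semigroup when passing to limits. *)
Lemma squeeze_order_interval (a b u : nat -> X) (x : X) :
  (forall n, order_interval le (a n) (b n) x) ->
  (forall n, order_interval le (a n) (b n) (u n)) ->
  mdist (a n) (b n) @[n --> \oo] --> (0 : R) -> u @ \oo --> x.
Proof.
move=> xI uI ab; apply: (@cvg_mdist0 _ _ (fun=> x)); last exact: cvg_cst.
apply: (@squeeze_cvgr _ _ _ _ (fun=> 0) (fun n => mdist (a n) (b n))) => //.
  by apply: nearW => n; rewrite mdist_ge0; exact: diag.
exact: cvg_cst.
Qed.

(** A nested-interval principle: the n-th interval contains the tail of u from
index n on, so its small diameter makes u Cauchy, and closedness keeps the limit
in it. *)
Lemma nested_order_intervals (a b u : nat -> X) :
  complete_metric X -> PreOrder le -> closed_preorder le ->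
  (forall n k, order_interval le (a n) (b n) (u (n + k)%N)) ->
  mdist (a n) (b n) @[n --> \oo] --> (0 : R) ->
  exists x, u @ \oo --> x /\ forall n, order_interval le (a n) (b n) x.
Proof.
move=> complete [le_refl _] closed uI ab.
have [|x ux] := complete u.
  apply: cauchy_exP => e e0.
  have [n _ /(_ n (leqnn n)) abn] := cvgr0_norm_lt _ ab _ e0.
  exists (u n), n => // k /= nk; rewrite ballEmdist /=.
  apply: le_lt_trans abn; apply: le_trans (ler_norm _); apply: diag.
    by rewrite -[X in u X]addn0.
  by rewrite -(subnKC nk).
exists x; split=> // n.
have unx : (fun k => u (k + n)%N) @ \oo --> x
  by apply: cvg_comp ux; exact: cvg_addnr.
split.
  apply: closed (cvg_cst (a n)) unx => k; rewrite addnC.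
  by case: (uI n k).
apply: closed unx (cvg_cst (b n)) => k; rewrite addnC.
by case: (uI n k).
Qed.

End OrderIntervals.

Section Semigroups.
Set Implicit Arguments.
Unset Strict Implicit.
Context (R : realType) (X : metricType R) (TT : set R) (T : R -> X -> X).

Lemma time_set_nat : is_time_set TT -> forall n : nat, TT n%:R.
Proof. by case=> -> n; [exact: ler0n | exists n]. Qed.

(** Both composites are the map at time s + t. *)
Lemma semigroupC : semigroup TT T ->
  forall s t x, TT s -> TT t -> T s (T t x) = T t (T s x).
Proof.
move=> [_ TD] s t x TTs TTt.
by have := TD s t TTs TTt; rewrite addrC TD// => /(congr1 (@^~ x)).
Qed.

Lemma cvg_natr_within : (forall n : nat, TT n%:R) ->
  (n%:R : R) @[n --> \oo] --> within TT (pinfty_nbhs R).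
Proof.
move=> TTn P PT.
have nearP : \forall n \near \oo, TT (n%:R : R) -> P n%:R
  by exact: (@cvgr_idn R _ PT).
by apply: filterS nearP => n; apply; exact: TTn.
Qed.

Lemma contractive_nat : is_time_set TT -> asymptotically_contractive TT T ->
  forall x y, mdist (T n%:R x) (T n%:R y) @[n --> \oo] --> (0 : R).
Proof.
move=> /time_set_nat TTn contr x y.
by apply: cvg_comp (contr x y); exact: cvg_natr_within.
Qed.

(** Any trajectory is asymptotic to the constant one at xs; for a second
stationary point this compares two constant sequences. *)
Lemma contractive_globally_stable xs :
  is_time_set TT -> asymptotically_contractive TT T -> stationary TT T xs ->
  globally_stable TT T.
Proof.
move=> TTtime contr sxs; exists xs; split; first split=> // y sy.
  have TTn := time_set_nat TTtime.
  apply: (cvg_unique (@metric_hausdorff _ X) (F := (fun=> xs) @ \oo)).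
    exact: cvg_cst.
  apply: (@cvg_mdist0 _ _ (fun=> y)); last exact: cvg_cst.
  have := contractive_nat TTtime contr y xs.
  by apply: cvg_trans; apply: near_eq_cvg; apply: nearW => n; rewrite sy ?sxs.
move=> x; apply: cvg_trans (contr x xs); apply: near_eq_cvg.
near=> t; rewrite sxs//; near: t; exact: withinT.
Unshelve. all: by end_near. Qed.

Lemma globally_stable_contractive :
  globally_stable TT T -> asymptotically_contractive TT T.
Proof.
move=> [xs [_ stab]] x y.
apply: (@squeeze_cvgr _ _ _ _ (fun=> 0)
  (fun t => mdist (T t x) xs + mdist (T t y) xs)).
- apply: nearW => t; rewrite mdist_ge0 /= (metric_sym (T t y)).
  exact: metric_triangle.
- exact: cvg_cst.
- by rewrite -[X in _ --> X]addr0; apply: cvgD; exact: stab.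
Qed.

(** The limit of the bounded trajectory along integer times is stationary: for
each t, both xs and T t xs are limits of T t (T n x), the former because T t and
T n commute and contractivity applies to x and T t x, the latter by squeezing. *)
Lemma order_bounded_stationary (le : X -> X -> Prop) x :
  PreOrder le -> complete_metric X -> diagonal_property le ->
  closed_preorder le -> is_time_set TT -> semigroup TT T ->
  order_preserving le TT T -> asymptotically_contractive TT T ->
  order_bounded_trajectory le TT T x ->
  exists xs, stationary TT T xs.
Proof.
move=> preo complete diag closed TTtime sg mono contr [a [b xab]].
have TTn := time_set_nat TTtime.
have cn := contractive_nat TTtime contr.
have TI s y z w : TT s -> order_interval le y z w ->
    order_interval le (T s y) (T s z) (T s w).
  by move=> TTs [yw wz]; split; exact: mono.
have xI n k : order_interval le (T n%:R a) (T n%:R b) (T (n + k)%:R x).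
  by rewrite natrD sg.2//; apply: TI => //; exact: xab.
have [xs [x_xs xsI]] := nested_order_intervals (u := fun n => T n%:R x)
  diag complete preo closed xI (cn a b).
exists xs => t TTt.
have to_Tt_xs : (fun n => T t (T n%:R x)) @ \oo --> T t xs.
  apply: (squeeze_order_interval diag
    (a := fun n => T t (T n%:R a)) (b := fun n => T t (T n%:R b))).
  - by move=> n; exact: TI.
  - by move=> n; apply: TI => //; have := xI n 0%N; rewrite addn0.
  - apply: cvg_trans (cn (T t a) (T t b)); apply: near_eq_cvg.
    by apply: nearW => n; rewrite !(semigroupC sg _ (TTn n) TTt).
have to_xs : (fun n => T t (T n%:R x)) @ \oo --> xs.
  apply: cvg_mdist0 x_xs; apply: cvg_trans (cn x (T t x)); apply: near_eq_cvg.
  by apply: nearW => n; rewrite (semigroupC sg _ (TTn n) TTt).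
exact: cvg_unique (@metric_hausdorff _ X) _ _ _ _ to_Tt_xs to_xs.
Qed.

End Semigroups.

Theorem theorem2p1 (R : realType) (X : metricType R)
    (le : X -> X -> Prop) (le_preorder : PreOrder le)
    (Xcomplete : complete_metric X)
    (Xdiagonal : diagonal_property le)
    (Xclosed : closed_preorder le)
    (TT : set R) (TTtime : is_time_set TT)
    (T : R -> X -> X)
    (Tsemigroup : semigroup TT T)
    (Tmono : order_preserving le TT T) :
  (asymptotically_contractive TT T /\
     exists x : X, order_bounded_trajectory le TT T x)
  <-> globally_stable TT T.
Proof.
split=> [[contr [x xbnd]]|stab].
  have [xs sxs] := order_bounded_stationary le_preorder Xcomplete Xdiagonal
    Xclosed TTtime Tsemigroup Tmono contr xbnd.
  exact: contractive_globally_stable sxs.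
split; first exact: globally_stable_contractive.
have [xs [[sxs _] _]] := stab; exists xs, xs, xs => t TTt.
by rewrite sxs//; split; apply: PreOrder_Reflexive.
Qed.
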